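(* Let $\Delta^\infty_0 = \{x\in \mathbb{R}^\infty \mid \sum_{i=1}^\infty x_i \leq 1 \text{ and } 0\leq x_i\leq 1 \text{ for all } i\}$, regarded as a subspace of $\mathbb{R}^\infty$ with the product topology. Suppose that $f:\Delta^\infty_0\rightarrow \Delta^\infty_0$ is continuous. Then $f$ has a fixed point, i.e. there exists $x\in\Delta^\infty_0$ with $f(x)=x$.
   Context: $\mathbb{R}^\infty$ denotes the product of countably infinitely many copies of $\mathbb{R}$, indexed by $i=1,2,3,\dots$, with the product topology; this topology is induced by the complete metric $\bar d(x,y) = \sum_{i=1}^\infty \frac{|x_i - y_i|}{2^i(1+|x_i-y_i|)}$. The set $\Delta^\infty_0$ (the standard infinite-dimensional simplex) is the closure in $\mathbb{R}^\infty$ of the convex hull of the standard basis vectors $e_i$, where $(e_i)_j=\delta_{ij}$. *)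

(* Defs.v *)
From mathcomp Require Import all_boot all_order all_algebra.
From mathcomp Require Import all_classical all_reals all_analysis.
Import Order.TTheory GRing.Theory Num.Theory.
Import numFieldNormedType.Exports.

Set Implicit Arguments.
Unset Strict Implicit.
Unset Printing Implicit Defensive.

Local Open Scope classical_set_scope.
Local Open Scope ring_scope.

(* Coordinates are numbered from 0 instead of 1, and {ptws nat -> R} carries the
   product topology.  The sum is taken in \bar R: it exists there because the
   coordinates are nonnegative, and it is +oo when the series diverges, whereas
   a real-valued limit would take a default value.
   The coercion of simplex R to a type is its subset type, which carries the
   topology induced by the inclusion (not the one of subspace (simplex R)). *)
Definition simplex (R : realType) : set {ptws nat -> R} :=
  [set x | (\sum_(0 <= i <oo) (x i)%:E <= 1)%E /\ forall i, 0 <= x i <= 1].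
Arguments simplex R : clear implicits.

(* Main.v *)
(* Brouwer's theorem is obtained from Scarf's lemma on families of linear orders,
   which replaces Sperner's lemma and needs no triangulation; it follows from a
   parity count of the pairs formed by an almost rainbow set and a point whose
   addition keeps the set dominant.  Apply it to the points of the n-dimensional
   simplex with coordinates in Z/N, ordered by each of the n+1 barycentric
   coordinates, a point being coloured by some i such that [f] does not decrease
   its i-th coordinate.  It yields a point such that, for every i, [f] does not
   decrease the i-th coordinate of some nearby point, up to an error O(n/N).  The
   limit over N along an ultrafilter is a point x with f(x)_i = x_i for i < n, and
   the limit of these points over n is a fixed point: both limits exist by
   Tychonoff's theorem. *)
Require Import Defs.
From mathcomp Require Import all_boot.
From mathcomp Require Import zify.

Set Implicit Arguments.
Unset Strict Implicit.
Unset Printing Implicit Defensive.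

(** * Dominant sets for finitely many linear orders *)

Section Rooms.
Variables (T I : finType) (r : I -> T -> nat).
Hypothesis r_inj : forall i, injective (r i).
Implicit Types (D S : {set T}) (i j k l : I) (x y z : T).

Definition dominant S := [forall y, exists i, forall x in S, r i y <= r i x].

Lemma dominantP S :
  reflect (forall y, exists i, forall x, x \in S -> r i y <= r i x)
    (dominant S).
Proof.
apply: (iffP forallP) => H y.
  by have /existsP[i /forall_inP Hi] := H y; exists i.
by apply/existsP; have [i Hi] := H y; exists i; apply/forall_inP.
Qed.

Lemma dominantS D S : D \subset S -> dominant S -> dominant D.
Proof.
move=> /subsetP DS /dominantP domS; apply/dominantP => y.
by have [i Hi] := domS y; exists i => x /DS; apply: Hi.
Qed.

Section Door.
Variables (D : {set T}) (m : I -> T).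
Hypotheses (domD : dominant D) (cardD : #|I| = #|D|.+1).
Hypotheses (mD : forall i, m i \in D)
  (m_min : forall i x, x \in D -> r i (m i) <= r i x).

(* A point z completing D to a dominant set is the new minimum for exactly one
   order k, so it lies above the old minima for all the others. *)
Definition above k z := [forall l, (l != k) ==> (r l (m l) < r l z)].

Lemma aboveP k z : reflect (forall l, l != k -> r l (m l) < r l z) (above k z).
Proof. exact: forall_inP. Qed.

(** Dominance tested at [x] itself yields an order whose minimum on [D] is [x]. *)
Lemma door_argmin_surj x : x \in D -> exists i, x = m i.
Proof.
move=> xD; have /dominantP/(_ x)[i Hi] := domD; exists i.
by apply: (@r_inj i); apply/eqP; rewrite eqn_leq Hi ?mD //= m_min.
Qed.

Lemma door_argmin_pair : exists i j, i != j /\ m i = m j.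
Proof.
have /injectivePn[i [j ij mij]] : ~~ injectiveb m.
  apply/negP => /injectiveP m_inj; have E := card_imset setT m_inj.
  have: #|m @: setT| <= #|D|.
    by apply/subset_leq_card/subsetP => _ /imsetP[i _ ->].
  by rewrite E cardsT cardD ltnn.
by exists i, j; rewrite eq_sym; split; first by rewrite eq_sym.
Qed.

(** The map [m] is onto [D] and stays onto without [i]; there are then as many orders as points, so
    it is injective there. *)
Lemma door_argmin_inj i j k l : i != j -> m i = m j ->
  k != i -> l != i -> m k = m l -> k = l.
Proof.
move=> ij mij ki li; have mi : m @: [set~ i] = D.
  apply/setP => x; apply/imsetP/idP => [[p _ ->] //|/door_argmin_surj[p ->]].
  have [->|pi] := eqVneq p i; last by exists p; rewrite ?inE.
  by exists j; rewrite ?inE // eq_sym.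
have /imset_injP minj : #|m @: [set~ i]| == #|[set~ i]|.
  by rewrite mi cardsC1 cardD.
by apply: minj; rewrite !inE.
Qed.

(** Each point of [D] stays minimal in some order other than [k], so [m] is onto [D] even without
    [k]; this forces [k] into the pair sharing a minimum. Dominance tested at [y] gives the
    maximality. *)
Lemma room_above i j z : i != j -> m i = m j -> z \notin D ->
    dominant (z |: D) ->
  exists2 k, (k == i) || (k == j) &
    above k z /\ forall y, above k y -> r k y <= r k z.
Proof.
move=> ij mij zD /dominantP domS.
have [k kz] := domS z.
have surj x : x \in D -> exists2 l, l != k & x = m l /\ r l (m l) < r l z.
  move=> xD; have [l lx] := domS x; have xE : x = m l.
    apply: (@r_inj l); apply/eqP; rewrite eqn_leq m_min // andbT.
    by apply: lx; rewrite !inE mD orbT.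
  have lz : r l (m l) < r l z.
    rewrite ltn_neqAle -xE lx ?setU11 // andbT; apply: contra zD => /eqP/r_inj.
    by move<-.
  exists l => //; apply: contraTneq lz => ->.
  by rewrite -leqNgt kz // !inE mD orbT.
have kij : (k == i) || (k == j).
  have [l lk [mkl _]] := surj _ (mD k).
  apply/norP => -[ki kj].
  have [li|li] := eqVneq l i.
    case/eqP: kj; apply: (@door_argmin_inj i j) => //; first by rewrite eq_sym.
    by rewrite mkl li.
  by case/eqP: lk; apply: (@door_argmin_inj i j).
have kinj l l' : l != k -> l' != k -> m l = m l' -> l = l'.
  by case/orP: kij => /eqP->; [apply: door_argmin_inj mij |
    apply: (@door_argmin_inj j i)] => //; rewrite eq_sym.
have kA : above k z.
  apply/aboveP => l lk; have [l' l'k [mll' lz]] := surj _ (mD l).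
  by rewrite (kinj _ _ lk l'k mll').
exists k => //; split=> // y /aboveP ky; have [l ly] := domS y.
suff <- : l = k by apply: ly; rewrite setU11.
apply/eqP/negPn/negP => lk; move: (ky _ lk).
by rewrite ltnNge ly // !inE mD orbT.
Qed.

(** A point [y] above for [i] can be dominated by [D] only in order [i], where it is also at most
    [z]; any other [y] is dominated in some order [l] other than [i], where [z] exceeds the minimum
    of [D]. *)
Lemma above_room i j z : i != j -> m i = m j ->
    above i z -> (forall y, above i y -> r i y <= r i z) ->
  z \notin D /\ dominant (z |: D).
Proof.
move=> ij mij /aboveP iz zmax; split.
  apply/negP => /door_argmin_surj[l zE].
  have [li|/iz] := eqVneq l i; last by rewrite -zE ltnn.
  have: r j (m j) < r j z by apply: iz; rewrite eq_sym.
  by rewrite -mij -li -zE ltnn.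
apply/dominantP => y; have [iy|] := boolP (above i y).
  exists i => x; rewrite in_setU1 => /orP[/eqP->|xD]; first exact: zmax.
  have /dominantP/(_ y)[l ly] := domD.
  have [<-|li] := eqVneq l i; first exact: ly.
  by move/aboveP: iy => /(_ _ li); rewrite ltnNge ly.
rewrite negb_forall => /existsP[l]; rewrite negb_imply -leqNgt => /andP[li ly].
exists l => x; rewrite in_setU1 => /orP[/eqP->|xD].
  by apply: leq_trans ly _; apply/ltnW/iz.
by apply: leq_trans ly _; apply: m_min.
Qed.

Definition top k :=
  [set z | above k z & [forall y, above k y ==> (r k y <= r k z)]].

Lemma topP k z :
  reflect (above k z /\ forall y, above k y -> r k y <= r k z) (z \in top k).
Proof.
by rewrite inE; apply: (iffP andP) => -[kz /forall_inP].
Qed.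

Lemma card_top k : #|top k| = [exists z, above k z].
Proof.
case: (boolP [exists z, above k z]) => [/existsP[z0 kz0]|].
  case: (arg_maxnP (r k) kz0) => z kz zmax; apply/eqP/cards1P; exists z.
  apply/setP => y; rewrite in_set1; apply/topP/eqP => [[ky ymax]|->];
    last first.
    by split=> // x; apply: zmax.
  by apply: (@r_inj k); apply/eqP; rewrite eqn_leq ymax // andbT; apply: zmax.
rewrite negb_exists => /forallP noz; apply/eqP; rewrite cards_eq0.
by apply/eqP/setP => z; rewrite !inE (negPf (noz z)).
Qed.

(** Each of the two orders sharing a minimum contributes at most one room; a point above for both
    would contradict the dominance of [D]. *)
Lemma card_rooms i j : i != j -> m i = m j ->
  #|[set z | z \notin D & dominant (z |: D)]| =
  [exists z, above i z] + [exists z, above j z].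
Proof.
move=> ij mij; rewrite -!card_top.
have -> : [set z | z \notin D & dominant (z |: D)] = top i :|: top j.
  apply/setP => z; rewrite inE in_setU; apply/andP/orP => [[zD zdom]|].
    by have [k /orP[] /eqP-> /topP] := room_above ij mij zD zdom; [left|right].
  case=> /topP[kz zmax]; first exact: above_room ij mij kz zmax.
  by apply: (@above_room j i) => //; rewrite eq_sym.
rewrite cardsU; suff -> : top i :&: top j = set0 by rewrite cards0 subn0.
apply/setP => z; rewrite in_setI in_set0.
apply/negP => /andP[/topP[iz _] /topP[/aboveP jz _]].
have /dominantP/(_ z)[k kz] := domD.
have ki : k = i.
  apply/eqP/negPn/negP => ki; move/aboveP: iz => /(_ _ ki).
  by rewrite ltnNge kz.
by have := jz _ ij; rewrite ltnNge -ki kz.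
Qed.

End Door.

(* The points [s i] are artificial vertices: [s i] is the least point for the
   order i and lies above every ordinary point for the other orders. *)
Section Slack.
Variables (s : I -> T) (c : T -> I) (x0 : T).
Hypotheses (I_gt1 : 1 < #|I|) (cs : cancel s c).
Hypotheses (s_min : forall i x, r i (s i) <= r i x).
Hypotheses (s_max : forall i j x,
  x \notin codom s -> j != i -> r i x < r i (s j)).
Hypothesis (x0s : x0 \notin codom s).

(** * Parity of the rooms at a door and of the doors of a room *)

Section Colour.
Variable i0 : I.

Definition door D := (#|I| == #|D|.+1) && (c @: D == [set~ i0]).

Lemma slack_door : door (s @: [set~ i0]).
Proof.
rewrite /door card_imset ?cardsC1; last exact: can_inj cs.
rewrite prednK ?eqxx /=; last exact: ltnW.
by rewrite -imset_comp (eq_imset _ cs) imset_id.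
Qed.

Lemma slack_dominant : dominant (s @: [set~ i0]).
Proof.
apply/dominantP => y; have [/codomP[k ->]|ys] := boolP (y \in codom s).
  by exists k.
exists i0 => _ /imsetP[l + ->]; rewrite !inE => li.
by apply/ltnW/s_max.
Qed.

Lemma odd_card_rooms D : door D ->
  odd #|[set z | z \notin D & dominant (z |: D)]| = (D == s @: [set~ i0]).
Proof.
move=> /andP[/eqP cardD /eqP cD].
have [domD|ndomD] := boolP (dominant D); last first.
  have -> : [set z | z \notin D & dominant (z |: D)] = set0.
    apply/setP => z; rewrite !inE; apply/negP => /andP[_].
    by move/(dominantS (subsetUr _ _)); apply/negP.
  rewrite cards0; apply/esym/negbTE; apply: contraNneq ndomD => ->.
  exact: slack_dominant.
have [d dD] : exists d, d \in D.
  by apply/card_gt0P; rewrite -ltnS -cardD.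
pose m i := [arg min_(x < d in D) r i x].
have mD i : m i \in D by rewrite /m; case: arg_minnP.
have m_min i x : x \in D -> r i (m i) <= r i x.
  by rewrite /m; case: arg_minnP => // y _; apply.
have [/subsetP Ds|/subsetPn[x xD xs]] := boolP (D \subset codom s).
  have DE : D = s @: [set~ i0].
    apply/setP => x; apply/idP/imsetP => [xD|[k + ->]].
      have /codomP[k xE] := Ds _ xD; exists k => //.
      by rewrite -cD -(cs k) -xE imset_f.
    rewrite -cD => /imsetP[y yD ->].
    by have /codomP[l yE] := Ds _ yD; rewrite yE cs -yE.
  have mE l : l != i0 -> m l = s l.
    move=> li; apply: (@r_inj l); apply/eqP.
    rewrite eqn_leq s_min andbT m_min //.
    by rewrite DE imset_f // !inE.
  have /imsetP[j] : m i0 \in s @: [set~ i0] by rewrite -DE.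
  rewrite !inE => ji mi0.
  have mj : m i0 = m j by rewrite mi0 mE.
  rewrite (card_rooms domD cardD mD m_min _ mj); last by rewrite eq_sym.
  have -> : D == s @: [set~ i0] by apply/eqP.
  (* Exactly one room: [x0] is above for [i0]. For [j] no point is: [s k] with [k != j] is least in
     order [k], and neither [s j] nor an ordinary point exceeds [m i0 = s j] in order [i0]. *)
  have -> : [exists z, above m i0 z].
    apply/existsP; exists x0; apply/aboveP => l /mE ->.
    rewrite ltn_neqAle s_min andbT; apply: contra x0s => /eqP/r_inj <-.
    exact: codom_f.
  have /negbTE -> // : ~~ [exists z, above m j z].
  rewrite negb_exists; apply/forallP => z; apply/negP => /aboveP jz.
  have [/codomP[k zE]|zs] := boolP (z \in codom s).
    have [kj|kj] := eqVneq k j.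
      by have := jz i0; rewrite mi0 zE kj ltnn eq_sym => /(_ ji).
    by have := jz k kj; rewrite zE ltnNge s_min.
  by have := jz i0; rewrite mi0 ltnNge eq_sym ltnW ?s_max // => /(_ ji).
have [i [j [ij mij]]] := door_argmin_pair cardD mD.
(* Two rooms: [s k] exceeds the ordinary point [x] in every order but [k]. *)
have aboveS k : [exists z, above m k z].
  apply/existsP; exists (s k); apply/aboveP => l lk.
  by apply: leq_ltn_trans (m_min _ _ xD) _; apply: s_max; rewrite // eq_sym.
rewrite (card_rooms domD cardD mD m_min ij mij) !aboveS; apply/esym/negbTE.
apply: contraNneq xs => DE; move: xD; rewrite DE => /imsetP[l _ ->].
exact: codom_f.
Qed.

(** If [S :\ z] is a door, then [S] misses [i0] and repeats exactly one colour; the doors arise by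
    removing either of the two points that share it. *)
Lemma even_card_doors S : c @: S != setT ->
  ~~ odd #|[set z in S | door (S :\ z)]|.
Proof.
move=> cS; have [->|[z]] := set_0Vmem [set z in S | door (S :\ z)].
  by rewrite cards0.
rewrite inE => /andP[zS zdoor]; have /andP[/eqP cardD /eqP cD] := zdoor.
have /imset_injP c_inj : #|c @: (S :\ z)| == #|S :\ z|.
  by rewrite cD cardsC1 cardD.
have : c z \in [set~ i0].
  rewrite !inE; apply: contra cS => /eqP cz; rewrite -(setD1K zS) imsetU1 cD cz.
  by apply/eqP/setP => k; rewrite !inE orbN.
rewrite -cD => /imsetP[x xD czx].
have /andP[xz xS] : (x != z) && (x \in S) by move: xD; rewrite !inE.
suff -> : [set z in S | door (S :\ z)] = [set z; x] by rewrite cards2 eq_sym xz.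
have im y y' : y \in S -> y' \in S -> y != y' -> c y = c y' ->
    c @: (S :\ y) = c @: S.
  move=> yS y'S yy' cyy'; rewrite -{2}(setD1K yS) imsetU1; apply/esym/setUidPr.
  by rewrite sub1set cyy' imset_f // !inE eq_sym yy'.
have cSE : c @: S = [set~ i0] by rewrite -cD (im z x) // eq_sym.
apply/setP => y; rewrite !inE; apply/andP/orP => [[yS /andP[_ /eqP cDy]]|].
  have [->|yz] := eqVneq y z; [by left | right].
  have : c y \in c @: (S :\ y) by rewrite cDy -cSE imset_f.
  move=> /imsetP[y' + cyy']; rewrite !inE => /andP[y'y y'S].
  have yD : y \in S :\ z by rewrite !inE yz.
  have [y'z|y'z] := eqVneq y' z.
    by apply/eqP/c_inj; rewrite // cyy' y'z.
  by case/eqP: y'y; apply/c_inj; rewrite // !inE y'z.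
case=> /eqP->; split=> //; rewrite /door (im x z) // cSE eqxx andbT cardD.
by have := cardsD1 z S; rewrite (cardsD1 x S) zS xS !add1n => ->.
Qed.

End Colour.

(* Both sides count the pairs (D, z) with S = z |: D. *)
Lemma sperner_count i0 :
  \sum_(D | door i0 D) #|[set z | z \notin D & dominant (z |: D)]| =
  \sum_(S | dominant S) #|[set z in S | door i0 (S :\ z)]|.
Proof.
under eq_bigr do rewrite -sum1dep_card.
under [RHS]eq_bigr do rewrite -sum1dep_card.
rewrite (exchange_big_dep predT) //= [RHS](exchange_big_dep predT) //=.
apply: eq_bigr => z _.
rewrite [RHS](reindex_onto (setU [set z]) (fun S => S :\ z)) /=; last first.
  by move=> S /and3P[_ zS _]; apply: setD1K.
apply: eq_bigl => D; rewrite setU11 /=.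
have [zD|zD] := boolP (z \in D).
  rewrite andbF; apply/esym/andP => -[_ /eqP DE].
  by move: zD; rewrite -DE !inE eqxx.
by rewrite setU1K // eqxx andbT andbC.
Qed.

(** Otherwise every term on the right of [sperner_count] is even, whereas on the left exactly one
    door gives an odd term. *)
Lemma sperner : exists2 S, dominant S & c @: S = setT.
Proof.
have [i0 _] : exists i0, i0 \in I by apply/card_gt0P; apply: ltnW.
have [/exists_inP[S domS /eqP cS]|] :=
  boolP [exists (S | dominant S), c @: S == setT].
  by exists S.
rewrite negb_exists_in => /forall_inP noS.
have : ~~ odd (\sum_(S | dominant S) #|[set z in S | door i0 (S :\ z)]|).
  rewrite -dvdn2; apply: dvdn_sum => S domS; rewrite dvdn2.
  by apply: even_card_doors; apply: noS.
rewrite -sperner_count (bigD1 _ (slack_door i0)) /= oddD.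
rewrite (odd_card_rooms (slack_door i0)) eqxx addTb negbK.
rewrite (_ : odd _ = false) //; apply/negbTE; rewrite -dvdn2.
apply: dvdn_sum => D /andP[dD /negbTE DE].
by rewrite dvdn2 (odd_card_rooms dD) DE.
Qed.

End Slack.
End Rooms.

(** * Scarf's lemma for orders with ties *)

Lemma scarf (G I : finType) (r : I -> G -> nat) (c : G -> I) :
    1 < #|I| -> 0 < #|G| ->
  exists A : {set G}, forall y, exists2 i, i \in c @: A &
    forall x, x \in A -> r i y <= r i x.
Proof.
move=> I1 /card_gt0P[x0 _].
(* [rk] breaks ties by the enumeration of [G], and [M] exceeds all its values. *)
pose M := (\sum_i \sum_x r i x).+1 * #|G|.
pose rk i (x : G) := r i x * #|G| + enum_rank x.
have rkM i x : rk i x < M.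
  rewrite /rk /M mulSn addnC -addSn leq_add ?ltn_ord // leq_mul2r.
  by rewrite (bigD1 i) //= (bigD1 x) //= -addnA leq_addr orbT.
have rkW i x y : rk i x <= rk i y -> r i x <= r i y.
  apply: contraTT; rewrite -!ltnNge => rxy.
  apply: (@leq_trans ((r i y).+1 * #|G|)); first by rewrite mulSnr ltn_add2l.
  by apply: leq_trans (leq_addr _ _); rewrite leq_mul2r rxy orbT.
(* The successor keeps 0 free for the artificial vertex [i]; the other artificial vertices lie
   beyond [M], separated by their ranks. *)
pose r' i (t : G + I) := match t with
  | inl x => (rk i x).+1
  | inr j => if j == i then 0 else M.+1 + enum_rank j
  end.
pose c' (t : G + I) := match t with inl x => c x | inr i => i end.
have r'_inj i : injective (r' i).
  move=> [x|j] [y|k] /=.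
  - move=> [E]; congr inl; apply: enum_rank_inj; apply: val_inj => /=.
    by rewrite -(modn_small (ltn_ord (enum_rank x)))
      -(modn_small (ltn_ord (enum_rank y)))
      -(modnMDl (r i x)) -/(rk i x) E modnMDl.
  - by case: eqP => // _ E; move: (rkM i x); lia.
  - by case: eqP => // _ E; move: (rkM i y); lia.
  - case: eqP => [->|_]; case: eqP => [->|_] //; try lia.
    by move=> [/addnI/val_inj/enum_rank_inj->].
have [| | | S /dominantP domS cS] :=
  @sperner _ _ r' r'_inj inr c' (inl x0) I1 (fun=> erefl).
- by move=> i t /=; rewrite eqxx.
- move=> i j [x _|k /negP[]] /=; last exact: codom_f.
  by rewrite eq_sym => /negbTE; have := rkM i x; case: eqP => //; lia.
- by apply/negP => /codomP[].
exists [set x | inl x \in S] => y; have [i Hi] := domS (inl y).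
exists i; last by move=> x; rewrite inE => /Hi /=; rewrite ltnS; apply: rkW.
(* The colour [i] must come from an ordinary point: the artificial vertex [i] has value 0 in order
   [i], below [y]. *)
have : i \in c' @: S by rewrite cS inE.
move=> /imsetP[[x|j] tS iE]; first by apply/imsetP; exists x; rewrite ?inE.
by have := Hi _ tS; rewrite /= iE eqxx.
Qed.

(** * Scarf's lemma on the integer points of a simplex *)

Definition grid n N := {x : {ffun 'I_n.+1 -> 'I_N.+1} | \sum_i x i == N}.

Lemma grid_above n N (w : 'I_n.+1 -> nat) : \sum_i w i <= N ->
  exists x : grid n N, forall i, w i <= val x i.
Proof.
(* The whole surplus is put on coordinate 0. *)
move=> wN; pose v i := w i + (i == ord0) * (N - \sum_i w i).
have vN : \sum_i v i = N.
  rewrite big_split /= [X in _ + X](bigD1 ord0) //= mul1n.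
  by rewrite [X in _ + (_ + X)]big1 ?addn0 ?subnKC // => i /negbTE ->.
have vi i : v i < N.+1 by rewrite ltnS -vN (bigD1 i) //= leq_addr.
have xN : \sum_i [ffun i => Ordinal (vi i)] i == N.
  by apply/eqP; rewrite -[RHS]vN; apply: eq_bigr => i _; rewrite ffunE.
by exists (exist _ [ffun i => Ordinal (vi i)] xN) => i; rewrite ffunE leq_addr.
Qed.

(** The minima [u] of [A], set to 0 for missing colours, sum to at least [N - n], so points of [A]
    exceed [u] by at most [n] in each coordinate. Hence they are close to each other, and small in
    the coordinates of missing colours. *)
Lemma grid_scarf n N (c : grid n N -> 'I_n.+1) : 0 < n ->
  exists x : grid n N, forall i, exists2 z : grid n N,
    c z = i \/ val z i <= n &
    forall j, val z j <= val x j + n /\ val x j <= val z j + n.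
Proof.
move=> n0; have [g0 _] : exists x : grid n N, forall i, 0 <= val x i.
  by apply: (@grid_above _ _ (fun=> 0)); rewrite big1.
have [||A HA] := @scarf (grid n N) 'I_n.+1 (fun i x => val x i) c.
- by rewrite card_ord.
- by apply/card_gt0P; exists g0.
have [_ /imsetP[a aA _] _] := HA g0.
pose m i := val [arg min_(x < a in A) val x i] i : nat.
have m_le i x : x \in A -> m i <= val x i.
  by rewrite /m; case: arg_minnP => // y _; apply.
pose u i := if i \in c @: A then m i else 0.
(* Otherwise some grid point is at least [u + 1] everywhere, so it beats the minimum of [A] in every
   order whose colour occurs. *)
have uN : N <= \sum_i u i + n.
  rewrite leqNgt; apply/negP => ltN.
  have [y Hy] : exists y : grid n N, forall i, u i + 1 <= val y i.
    by apply: grid_above; rewrite big_split /= sum_nat_const card_ord muln1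
      addnS.
  have [i iA Hi] := HA y.
  have := Hy i; rewrite /u iA addn1 ltnNge /m; case: arg_minnP => // x xA _.
  by rewrite Hi.
have u_le i x : x \in A -> u i <= val x i.
  by move=> xA; rewrite /u; case: ifP => // _; apply: m_le.
have le_u j x : x \in A -> val x j <= u j + n.
  move=> xA; have /eqP := valP x; rewrite (bigD1 j) //= => xN.
  have : \sum_(i | i != j) u i <= \sum_(i | i != j) val x i.
    by apply: leq_sum => i _; apply: u_le.
  by move: uN; rewrite (bigD1 j) //=; move: xN; lia.
have close x z j : x \in A -> z \in A -> val z j <= val x j + n.
  by move=> xA zA; apply: leq_trans (le_u _ _ zA) _; rewrite leq_add2r u_le.
exists a => i; have [/imsetP[z zA ->]|iA] := boolP (i \in c @: A).
  by exists z => [|j]; [left | split; apply: close].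
exists a => [|j]; last by split; apply: leq_addr.
by right; apply: leq_trans (le_u i a aA) _; rewrite /u (negbTE iA).
Qed.

(* Convergence and compactness in the simplex *)
From mathcomp Require Import all_order all_algebra.
From mathcomp Require Import all_classical all_reals all_analysis.
Import Order.TTheory GRing.Theory Num.Theory.
Import numFieldNormedType.Exports.

Local Open Scope classical_set_scope.
Local Open Scope ring_scope.

(** Each condition here involves finitely many coordinates, hence passes to pointwise limits. *)
Lemma simplexP (R : realType) (x : nat -> R) :
  (x : {ptws nat -> R}) \in simplex R <->
  (forall i, 0 <= x i) /\ forall n, \sum_(0 <= i < n) x i <= 1.
Proof.
split=> [/set_mem[x1 x01]|[x0 x1]].
  split=> [i|n]; first by case/andP: (x01 i).
  rewrite -lee_fin; apply: le_trans x1; rewrite -sumEFin.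
  by apply: nneseries_lim_ge => i _ _; rewrite lee_fin; case/andP: (x01 i).
apply/mem_set; split=> [|i].
  apply: lime_le.
    by apply: is_cvg_nneseries => i _ _; rewrite lee_fin.
  by apply: nearW => n; rewrite sumEFin lee_fin.
rewrite x0 /=; apply: le_trans (x1 i.+1).
by rewrite big_nat_recr //= lerDr sumr_ge0.
Qed.

Section SimplexTopology.
Variable R : realType.
Implicit Types x : simplex R.

Lemma simplex_ge0 x i : 0 <= val x i.
Proof. by have /simplexP[] := valP x. Qed.

Lemma simplex_sum_le1 x n : \sum_(0 <= i < n) val x i <= 1.
Proof. by have /simplexP[] := valP x. Qed.

Lemma cvg_simplexP (T : Type) (F : set_system T) {FF : Filter F}
    (u : T -> simplex R) x :
  u @ F --> x <-> forall i, (fun t => val (u t) i) @ F --> val x i.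
Proof.
split=> [ux i|ux].
  apply: (@cvg_comp _ _ _ u (fun y : simplex R => val y i) _ _ _ ux).
  apply: (@continuous_comp _ _ _ (val : simplex R -> {ptws nat -> R})
    (fun y : {ptws nat -> R} => y i)).
    exact: initial_continuous.
  exact: proj_continuous.
have vx : (val \o u) @ F --> (val x : {ptws nat -> R}).
  exact/pointwise_cvgP.
move=> A /= [_ [[B Bop <-] Bx BA]].
rewrite nbhs_filterE; apply: (filterS (fun t => BA (u t))).
by apply: vx; apply: open_nbhs_nbhs.
Qed.

Lemma ultra_cvg_simplex (U : set_system nat) (u : nat -> simplex R) :
  UltraFilter U -> exists x, u @ U --> x.
Proof.
move=> UU; have PU := @ultra_proper _ _ UU.
pose K := [set y : {ptws nat -> R} | forall i, y i \in `[0, 1]].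
have : compact K.
  apply: (@tychonoff _ (fun _ : nat => R) (fun _ => `[0, 1]%classic)) => i.
  exact: segment_compact.
move=> /(_ ((val \o u) @ U)) [].
  apply: nearW => n i; rewrite in_itv /= simplex_ge0 /=.
  by have [_ /(_ i) /andP[]] := set_mem (valP (u n)).
move=> p [_ clp].
have cvp : (val \o u) @ U --> (p : {ptws nat -> R}).
  (* A cluster point of an ultrafilter is a limit: if [V] were not in the filter, its complement
     would be, and would have to meet [V]. *)
  move=> V pV; have [//|UV] := in_ultra_setVsetC ((val \o u) @^-1` V) UU.
  have [y [/= nVy Vy]] := clp (~` V) V UV pV.
  by [].
have cvi i : (fun n => val (u n) i) @ U --> p i.
  by move/pointwise_cvgP: cvp; apply.
have pS : p \in simplex R.
  apply/simplexP; split=> [i|n].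
    by apply: (cvgr_to_ge (cvi i)); apply: nearW => k; apply: simplex_ge0.
  have : (fun k => \sum_(0 <= i < n) val (u k) i) @ U --> \sum_(0 <= i < n) p i.
    apply: cvg_big => //; exact: add_continuous.
  by move/cvgr_to_le; apply; apply: nearW => k; apply: simplex_sum_le1.
exists (SigSub pS : simplex R).
by apply/cvg_simplexP => i; exact: cvi.
Qed.
End SimplexTopology.

(** * Grid points as points of the simplex *)

Section GridPoint.
Variables (R : realType) (n N : nat).
Implicit Types z : grid n N.+1.

(** Beyond [n], [inord] would fall back to index 0, hence the test. *)
Definition grid_coord z i : nat := if (i < n.+1)%N then val z (inord i) else 0.

Lemma grid_coordE z (j : 'I_n.+1) : grid_coord z j = val z j.
Proof. by rewrite /grid_coord ltn_ord inord_val. Qed.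

Lemma sum_grid_coord z : (\sum_(0 <= i < n.+1) grid_coord z i = N.+1)%N.
Proof.
have /eqP <- := valP z; rewrite big_mkord.
by apply: eq_bigr => j _; rewrite grid_coordE.
Qed.

Lemma sum_grid_coord_le z k : (\sum_(0 <= i < k) grid_coord z i <= N.+1)%N.
Proof.
apply: (@leq_trans (\sum_(0 <= i < n.+1 + k) grid_coord z i)).
  by rewrite [leqRHS](@big_cat_nat _ _ _ k) //= ?leq_addr // leq_addl.
rewrite (@big_cat_nat _ _ _ n.+1) //= ?leq_addr // sum_grid_coord.
rewrite big_nat_cond big1 ?addn0 // => i /andP[/andP[ni _] _].
by rewrite /grid_coord ltnNge ni.
Qed.

Lemma grid_point_subproof z :
  ((fun i => (grid_coord z i)%:R / N.+1%:R) : {ptws nat -> R}) \in simplex R.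
Proof.
apply/simplexP; split=> [i|k]; first by rewrite divr_ge0.
rewrite -mulr_suml -natr_sum ler_pdivrMr ?ltr0n // mul1r ler_nat.
exact: sum_grid_coord_le.
Qed.

Definition grid_point z : simplex R := SigSub (grid_point_subproof z).

End GridPoint.

(** * Points with finitely many fixed coordinates *)

Section FixedPoint.
Variables (R : realType) (f : simplex R -> simplex R).
Hypothesis hf : continuous f.
Implicit Types x y z : simplex R.

Section FiniteStage.
Variable n : nat.

(* The displacement of [f] in the barycentric coordinates of the n-dimensional
   simplex; the last one is the slack, 1 minus the sum of the first n. *)
Definition displacement (i : 'I_n.+1) x : R :=
  if (i < n)%N then val (f x) i - val x i
  else \sum_(0 <= j < n) (val x j - val (f x) j).

(** The displacements sum to 0. *)
Lemma displacement_ge0 x : exists i, 0 <= displacement i x.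
Proof.
have [/existsP //|] := boolP [exists i, 0 <= displacement i x].
rewrite negb_exists => /forallP lt0; exists ord_max.
rewrite /displacement /= ltnn big_nat_cond.
apply: sumr_ge0 => j /andP[/andP[_ jn] _].
have := lt0 (widen_ord (leqnSn n) (Ordinal jn)).
by rewrite /displacement /= jn -ltNge subr_lt0 subr_ge0 => /ltW.
Qed.

(** A barycentric coordinate cannot decrease by more than its own value. For the slack, this uses
    that coordinate [n] of a grid point is 1 minus the sum of the first [n]. *)
Lemma displacement_grid N (z : grid n N.+1) i : (val z i <= n)%N ->
  - (n%:R / N.+1%:R) <= displacement i (grid_point R z).
Proof.
move=> zin; have zi : (grid_coord z i)%:R / N.+1%:R <= n%:R / N.+1%:R :> R.
  by rewrite ler_wpM2r ?invr_ge0 // ler_nat grid_coordE.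
rewrite /displacement; case: ltnP => [_|ni].
  rewrite lerBrDr addrC -lerBrDr opprK.
  by apply: le_trans zi _; rewrite lerDr simplex_ge0.
have {}ni : i = n :> nat by apply/eqP; rewrite eqn_leq ni -ltnS ltn_ord.
have : \sum_(0 <= j < n.+1) val (grid_point R z) j = 1.
  by rewrite -mulr_suml -natr_sum sum_grid_coord divff.
rewrite ni in zi; rewrite sumrB big_nat_recr //=.
move/(canRL (addrK _)) ->; have := simplex_sum_le1 (f (grid_point R z)) n.
by move=> fle1; rewrite lerBrDr [leRHS]addrC lerD // lerN2.
Qed.

Lemma displacement_cvg (U : set_system nat) (z : nat -> simplex R) x i :
  Filter U -> z @ U --> x ->
  (fun N => displacement i (z N)) @ U --> displacement i x.
Proof.
move=> FU zx; have fzx : (f \o z) @ U --> f x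
  by exact: (@cvg_comp _ _ _ z f U (nbhs x) (nbhs (f x)) zx (@hf x)).
move/cvg_simplexP: zx => zx; move/cvg_simplexP: fzx => fzx.
rewrite /displacement; case: ltnP => _; first exact: cvgB.
by apply: cvg_big => [|j _]; [exact: add_continuous | exact: cvgB].
Qed.

Lemma almost_displacement_ge0 N : (0 < n)%N ->
  exists x, forall i, exists2 z, - (n%:R / N.+1%:R) <= displacement i z &
    forall j, `|val z j - val x j| <= n%:R / N.+1%:R.
Proof.
move=> n0; have /choice[c cP] (z : grid n N.+1) :=
  displacement_ge0 (grid_point R z).
have [x Hx] := grid_scarf c n0; exists (grid_point R x) => i.
have [z ciz zx] := Hx i; exists (grid_point R z).
  case: ciz => [<-|]; last exact: displacement_grid.
  by apply: le_trans (cP z); rewrite oppr_le0 divr_ge0.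
move=> j; rewrite /= -mulrBl normrM [X in _ * X]ger0_norm ?invr_ge0 //.
rewrite ler_wpM2r ?invr_ge0 // ler_distl.
rewrite /grid_coord; case: ifP => _; last by rewrite sub0r oppr_le0 add0r !ler0n.
by have [zx1 zx2] := zx (inord j); rewrite lerBlDr -!natrD !ler_nat zx1 zx2.
Qed.

(** In the limit over [N] all displacements at [x] are nonnegative; as they sum to 0, they
    vanish. *)
Lemma fixed_coordinates : (0 < n)%N ->
  exists x, forall i, (i < n)%N -> val (f x) i = val x i.
Proof.
move=> n0; have /choice[u uP] N := almost_displacement_ge0 N n0.
have [U [UU leU]] := ultraFilterLemma (@eventually_filter).
have PU := @ultra_proper _ _ UU.
have [x ux] := ultra_cvg_simplex u UU.
have cvg0 : (fun N => n%:R / N.+1%:R : R) @ U --> 0.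
  rewrite -[X in _ --> X](mulr0 n%:R); apply: cvgM; first exact: cvg_cst.
  by apply: cvg_trans (@cvg_harmonic R) => A /leU.
have ge0 i : 0 <= displacement i x.
  have /choice[z zP] N : exists z, - (n%:R / N.+1%:R) <= displacement i z /\
      forall j, `|val z j - val (u N) j| <= n%:R / N.+1%:R.
    by have [z z1 z2] := uP N i; exists z.
  (* The witnesses depend on [i], but they approach [u] and so have the same limit. *)
  have zx : z @ U --> x.
    apply/cvg_simplexP => j.
    move/cvg_simplexP: ux => /(_ j) ux.
    have : (fun N => val (z N) j - val (u N) j) @ U --> 0.
      apply/cvgr0Pnorm_le => e e0.
      move/cvgr0Pnorm_le: cvg0 => /(_ e e0); apply: filterS => N.
      by apply: le_trans; apply: le_trans (ler_norm _); case: (zP N).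
    move=> /cvgD/(_ ux); rewrite add0r => zx.
    apply: cvg_trans zx; apply: near_eq_cvg; apply: nearW => N /=.
    by rewrite !fctE subrK.
  have := cvgD (@displacement_cvg U z x i _ zx) cvg0.
  move=> /(_ _ _)/cvgr_to_ge; rewrite addr0; apply; apply: nearW => N /=.
  by rewrite -lerBlDr sub0r; case: (zP N).
exists x => i ni.
have le0 j : (j < n)%N -> 0 <= val (f x) j - val x j.
  by move=> jn; have := ge0 (widen_ord (leqnSn n) (Ordinal jn));
    rewrite /displacement /= jn.
have := ge0 ord_max; rewrite /displacement /= ltnn big_mkord.
rewrite (bigD1 (Ordinal ni)) //=.
have : \sum_(j < n | j != Ordinal ni) (val x j - val (f x) j) <= 0.
  by apply: sumr_le0 => j _; rewrite -oppr_ge0 opprB le0.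
move=> sum_le0 /le_trans tr; apply/le_anti; rewrite -subr_ge0 tr ?gerDl //=.
by rewrite -subr_ge0 le0.
Qed.

End FiniteStage.

End FixedPoint.

(** * Passage to the limit over the dimension *)

Theorem theorem1 (R : realType) (f : simplex R -> simplex R)
  (hf : continuous f) : exists x : simplex R, f x = x.
Proof.
have /choice[u uP] n := fixed_coordinates hf (ltn0Sn n).
have [U [UU leU]] := ultraFilterLemma (@eventually_filter).
have PU := @ultra_proper _ _ UU.
have [x ux] := ultra_cvg_simplex u UU.
exists x; apply: val_inj; apply/funext => i.
have fux : (f \o u) @ U --> f x
  by exact: (@cvg_comp _ _ _ u f U (nbhs x) (nbhs (f x)) ux (@hf x)).
move/cvg_simplexP: ux => /(_ i) ux; move/cvg_simplexP: fux => /(_ i) fux.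
(* For [n >= i] the points [f (u n)] and [u n] have the same coordinate [i], so both limits agree
   there. *)
apply: (norm_cvg_unique fux); apply: cvg_trans ux.
apply: near_eq_cvg; apply: leU; exists i => // n /= ni.
by rewrite uP.
Qed.
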